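(* For $n\ge 2$ define the polynomial in $x$ (with parameter $t$) $$h_n(x;t)=\sum_{d=1}^{n-1}\sum_{i=1}^{d}\binom{n-i-1}{d-i}\binom{n-d-1}{i-1}\,t^i x^d,$$ and let $h_n'$, $h_n''$ denote derivatives with respect to $x$. Then for $n\ge 2$: $$h_{n+2}(x;t)=(1+x)h_{n+1}(x;t)+tx\,h_n(x;t),$$ $$A\,h_{n+1}(x;t)=B\,h_n(x;t)+C\,h_n'(x;t),$$ $$\widetilde A\,h_{n+1}(x;t)=\widetilde B\,h_n(x;t)+C^2\,h_n''(x;t),$$ where $A=(n-1)(x-1)$, $B=-n(2tx+x+1)$, $C=x(x^2+4tx+2x+1)$, $$\widetilde A=(n-1)\big((n-2)x^3+(4nt+n-2t+2)x^2-(4nt+n-6t-4)x-n\big),$$ $$\widetilde B=-n\big((nt-5t-2)x^3+(4nt^2+2nt-8t^2+n-6t-5)x^2+(5nt+2n-9t-4)x+n-1\big).$$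
   Context: Binomial coefficients $\binom{m}{k}$ are taken to be $0$ when $k>m$ or $k<0$. Equivalently $h_n(x;t)=\sum_{d=1}^{n-1}g_{U_{n,d}}(t)x^d$, where $g_{U_{n,d}}(t)=\sum_{i=1}^{\min(d,n-d)}\frac{(n-i-1)!}{(d-i)!(n-d-i)!(i-1)!}t^i$ is Speyer's $g$-polynomial of the uniform matroid $U_{n,d}$. *)

(* Defs.v *)
From HB Require Import structures.
From mathcomp Require Export all_boot all_order all_algebra.

Set Implicit Arguments.
Unset Strict Implicit.
Unset Printing Implicit Defensive.

Import GRing.Theory.
Local Open Scope ring_scope.

(* The parameter t is an arbitrary element of an arbitrary commutative ring R:
   t = 'X in R = {poly int} gives the identities with t an indeterminate.
   The nat subtractions never truncate, since 1 <= i <= d <= n - 1. *)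
Definition h (R : comNzRingType) (t : R) (n : nat) : {poly R} :=
  \sum_(1 <= d < n) \sum_(1 <= i < d.+1)
    ('C(n - i - 1, d - i)%:R * 'C(n - d - 1, i - 1)%:R * t ^+ i) *: 'X^d.

Section Coefficients.

Variables (R : comNzRingType) (t : R) (n : nat).

Local Notation x := ('X : {poly R}).
Local Notation T := (t%:P : {poly R}).
Local Notation N := (n%:R : {poly R}).

Definition coefA : {poly R} := (N - 1) * (x - 1).

Definition coefB : {poly R} := - N * (2 * T * x + x + 1).

Definition coefC : {poly R} := x * (x ^+ 2 + 4 * T * x + 2 * x + 1).

Definition coefA' : {poly R} :=
  (N - 1) * ((N - 2) * x ^+ 3
             + (4 * N * T + N - 2 * T + 2) * x ^+ 2
             - (4 * N * T + N - 6 * T - 4) * x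
             - N).

Definition coefB' : {poly R} :=
  - N * ((N * T - 5 * T - 2) * x ^+ 3
         + (4 * N * T ^+ 2 + 2 * N * T - 8 * T ^+ 2 + N - 6 * T - 5) * x ^+ 2
         + (5 * N * T + 2 * N - 9 * T - 4) * x
         + N - 1).

End Coefficients.

(* Main.v *)
(** The coefficient of [t x^(d+1)] in [h_(d+e+2)] is a weighted Delannoy number
    [D(d,e)], for which Pascal's rule gives
    [D(d+1,e+1) = D(d+1,e) + D(d,e+1) + t D(d,e)].  Summing along antidiagonals
    is the three-term recurrence.  The first-order identity follows from it by
    induction on [n], and differentiating that identity, then eliminating
    [h_n'] and [h_(n+1)'] with it, gives the second-order one. *)

Require Import Defs.
From mathcomp Require Import ring zify.
Import GRing.Theory.
Local Open Scope ring_scope.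

Section Delannoy.

Variables (R : comNzRingType) (t : R).

(** Lattice paths from (0,0) to (d,e) with steps (1,0), (0,1), (1,1), weighted by [t] per diagonal
    step: with i diagonals, place the d - i horizontal steps among all d + e - i, then choose the
    diagonals among the e others. *)
Definition delannoy (d e : nat) : R :=
  \sum_(i < d.+1) 'C(d + e - i, d - i)%:R * 'C(e, i)%:R * t ^+ i.

Lemma delannoy0n e : delannoy 0 e = 1.
Proof. by rewrite /delannoy big_ord1 !bin0 !mulr1. Qed.

Lemma delannoyn0 d : delannoy d 0 = 1.
Proof.
rewrite /delannoy big_ord_recl big1 => [|i _].
  by rewrite !subn0 addn0 binn bin0 !mulr1 addr0.
by rewrite bin0n mulr0 mul0r.
Qed.

Lemma delannoySS d e :
  delannoy d.+1 e.+1 =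
  delannoy d.+1 e + delannoy d e.+1 + t * delannoy d e.
Proof.
(* Pascal's rule is applied to one binomial at a time; [F] is the intermediate summand, with the
   first binomial of D(d+1,e) and the second of D(d+1,e+1). *)
pose F i := 'C(d.+1 + e - i, d.+1 - i)%:R * 'C(e.+1, i)%:R * t ^+ i.
have -> : delannoy d.+1 e.+1 = \sum_(i < d.+2) F i + delannoy d e.+1.
  rewrite /delannoy [LHS]big_ord_recr [X in _ = X + _]big_ord_recr /=.
  rewrite /F !subnn !bin0 addrAC -big_split /=; congr (_ + _).
  apply: eq_bigr => i _.
  have -> : (d.+1 + e.+1 - i = (d + e.+1 - i).+1)%N by have := ltn_ord i; lia.
  have -> : (d.+1 - i = (d - i).+1)%N by have := ltn_ord i; lia.
  by rewrite binS natrD addSnnS !mulrDl.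
rewrite [RHS]addrAC; congr (_ + _).
rewrite /delannoy mulr_sumr [LHS]big_ord_recl [X in _ = X + _]big_ord_recl.
rewrite -addrA -big_split /= /F !bin0; congr (_ + _).
apply: eq_bigr => i _; rewrite /bump /= add1n addSn !subSS binS natrD exprS.
by ring.
Qed.

Definition delannoy_poly (m : nat) : {poly R} :=
  \poly_(d < m.+1) delannoy d (m - d).

Lemma delannoy_polySS m :
  delannoy_poly m.+2 =
  (1 + 'X) * delannoy_poly m.+1 + t%:P * 'X * delannoy_poly m.
Proof.
apply/polyP => -[|d]; rewrite mulrDl mul1r -mulrA !coefD coefCM !coefXM /=.
  by rewrite !coef_poly /= !delannoy0n mulr0 !addr0.
(* At degree d+1: the Delannoy recurrence if d <= m, zero on both sides if d > m+1, and the boundary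
   value 1 if d = m+1. *)
rewrite !coef_poly !ltnS; case: (ltngtP d m.+1) => [dm|md|->].
- rewrite -ltnS dm; have -> : (m.+2 - d.+1 = (m - d).+1)%N by lia.
  by rewrite subSS subSn // delannoySS.
- have -> : (d <= m)%N = false by lia.
  by rewrite mulr0 !addr0.
by rewrite ltnn !subnn !delannoyn0 mulr0 addr0 add0r.
Qed.

(** Lowering both summation indices by one releases the factors [t] and ['X] and turns the binomials
    into those of D(d, m-d). *)
Lemma h_delannoy m : h t m.+2 = t%:P * 'X * delannoy_poly m.
Proof.
rewrite /h /delannoy_poly poly_def big_add1 big_mkord mulr_sumr /=.
apply: eq_bigr => d _; rewrite -scaler_suml big_add1 big_mkord.
rewrite -mulrA -scalerAr -exprS mul_polyC scalerA.
congr (_ *: _); rewrite /delannoy mulr_sumr; apply: eq_bigr => i _.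
have -> : (m.+2 - i.+1 - 1 = d + (m - d) - i)%N by have := ltn_ord d; lia.
have -> : (m.+2 - d.+1 - 1 = m - d)%N by lia.
by rewrite subSS subn1 exprS /=; ring.
Qed.

End Delannoy.

Section Recurrences.

Variables (R : comNzRingType) (t : R).

Lemma h_recurrence m :
  h t m.+4 = (1 + 'X) * h t m.+3 + t%:P * 'X * h t m.+2.
Proof. by rewrite !h_delannoy delannoy_polySS; ring. Qed.

Lemma h2 : h t 2 = t%:P * 'X.
Proof.
by rewrite h_delannoy /delannoy_poly poly_def big_ord1 delannoy0n scale1r mulr1.
Qed.

Lemma h3 : h t 3 = t%:P * 'X * (1 + 'X).
Proof.
rewrite h_delannoy /delannoy_poly poly_def !big_ord_recr big_ord0 /=.
by rewrite delannoy0n delannoyn0 !scale1r add0r.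
Qed.

Lemma h_deriv m :
  coefA R m.+2 * h t m.+3 =
  coefB t m.+2 * h t m.+2 + coefC t * (h t m.+2)^`().
Proof.
(* Two consecutive instances are carried, since the recurrence reaches two steps back. *)
suff [] : coefA R m.+2 * h t m.+3 =
          coefB t m.+2 * h t m.+2 + coefC t * (h t m.+2)^`() /\
          coefA R m.+3 * h t m.+4 =
          coefB t m.+3 * h t m.+3 + coefC t * (h t m.+3)^`() by [].
elim: m => [|m [IH0 IH1]].
  rewrite h_recurrence h2 h3 !derivE /coefA /coefB /coefC.
  by split; ring.
split=> //; rewrite (h_recurrence m.+1).
(* The differentiated recurrence is multiplied by [coefC t], so that each derivative can be
   eliminated without division. *)
have E : coefC t * (h t m.+4)^`() =
  coefC t * h t m.+3 + (1 + 'X) * (coefC t * (h t m.+3)^`())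
  + t%:P * (coefC t * h t m.+2) + t%:P * 'X * (coefC t * (h t m.+2)^`()).
  by rewrite h_recurrence !derivE; ring.
have {}IH0 : coefC t * (h t m.+2)^`() =
  coefA R m.+2 * h t m.+3 - coefB t m.+2 * h t m.+2 by rewrite IH0; ring.
have {}IH1 : coefC t * (h t m.+3)^`() =
  coefA R m.+3 * h t m.+4 - coefB t m.+3 * h t m.+3 by rewrite IH1; ring.
rewrite E IH0 IH1 h_recurrence /coefA /coefB /coefC.
by ring.
Qed.

Lemma h_deriv2 m :
  coefA' t m.+2 * h t m.+3 =
  coefB' t m.+2 * h t m.+2 + coefC t ^+ 2 * (h t m.+2)^`(2).
Proof.
have D0 : coefC t * (h t m.+2)^`() =
  coefA R m.+2 * h t m.+3 - coefB t m.+2 * h t m.+2.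
  by rewrite h_deriv; ring.
have D1 : coefC t * (h t m.+3)^`() =
  coefA R m.+3 * h t m.+4 - coefB t m.+3 * h t m.+3.
  by rewrite h_deriv; ring.
(* Differentiate the first-order relation and multiply by [c]: first derivatives then occur only as
   [c * p^]()[and]c * q^[()], which [D0] and [D1] replace. *)
have D2 (a b c p q : {poly R}) : a * q = b * p + c * p^`() ->
    c ^+ 2 * p^`(2) = a^`() * c * q + a * (c * q^`())
                      - b^`() * c * p - (b + c^`()) * (c * p^`()).
  move/(congr1 (@deriv R)); rewrite derivD !derivM => E.
  have -> : c ^+ 2 * p^`(2) = c * (b^`() * p + b * p^`()
      + (c^`() * p^`() + c * p^`()^`()) - b^`() * p - b * p^`() - c^`() * p^`()).
    by rewrite derivSn derivn1; ring.
  by rewrite -E; ring.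
have dA : (coefA R m.+2)^`() = m.+2%:R - 1.
  by rewrite /coefA -polyC_natr !derivE; ring.
have dB : (coefB t m.+2)^`() = - m.+2%:R * (2 * t%:P + 1).
  by rewrite /coefB -!polyC_natr !derivE; ring.
have dC : (coefC t)^`() = 3 * 'X ^+ 2 + 8 * t%:P * 'X + 4 * 'X + 1.
  by rewrite /coefC -!polyC_natr !derivE; ring.
(* [D1] brings in [h t m.+4]; the recurrence returns it to [h t m.+3] and [h t m.+2]. *)
rewrite (D2 _ _ _ _ _ (h_deriv m)) D0 D1 h_recurrence dA dB dC /coefA' /coefB' /coefA /coefB /coefC.
by ring.
Qed.

End Recurrences.

Theorem theorem2p1 (R : comNzRingType) (t : R) (n : nat) (hn : (2 <= n)%N) :
  [/\ h t n.+2 = (1 + 'X) * h t n.+1 + t%:P * 'X * h t n,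
      coefA R n * h t n.+1 = coefB t n * h t n + coefC t * (h t n)^`()
    & coefA' t n * h t n.+1 = coefB' t n * h t n + coefC t ^+ 2 * (h t n)^`(2)].
Proof.
case: n hn => [|[|m]] // _.
by split; [exact: h_recurrence | exact: h_deriv | exact: h_deriv2].
Qed.
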